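(* Let $r\ge1$ and let $\widetilde{\mathfrak{k}}$ be the fix-point Lie subalgebra of the untwisted affine Lie algebra $\widetilde{\mathfrak{sp}}_r(\mathbb{C})$ with respect to its Chevalley involution $\widetilde\omega$. For $s,t\in\mathbb{C}$ let $\chi_{s,t}$ be the one-dimensional representation of $\widetilde{\mathfrak{k}}$ with $\chi_{s,t}(Y_0)=s$, $\chi_{s,t}(Y_i)=0$ for $1\le i<r$, and $\chi_{s,t}(Y_r)=t$. Then $$\chi_{s,t}(y_{\pm\alpha+2k\delta})=\pm t\qquad(\alpha\in\Phi_+^\ell,\ k\in\mathbb{Z}),$$ $$\chi_{s,t}(y_{\mp\alpha+(2k+1)\delta})=\pm s\qquad(\alpha\in\Phi_+^\ell,\ k\in\mathbb{Z}),$$ $$\chi_{s,t}(y_{\alpha+k\delta})=0\qquad(\alpha\in\Phi^s,\ k\in\mathbb{Z}).$$ Furthermore, $\chi_{s,t}(y_{k\delta}^{(i)})=0$ for $k\in\mathbb{Z}\setminus\{0\}$ and $1\le i\le r$.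
   Context: Finite data: $\mathfrak{g}=\mathfrak{sp}_r(\mathbb{C})$ is the Lie algebra of complex $2r\times2r$ matrices $\begin{pmatrix} B & C \\ D & -B^T \end{pmatrix}$ with $B,C,D\in\mathfrak{gl}_r(\mathbb{C})$, $C^T=C$, $D^T=D$; $\omega(X)=-X^T$ is its Chevalley involution. Let $E_{k,\ell}$ be the matrix units of $\mathfrak{gl}_r(\mathbb{C})$, $\mathfrak{h}$ the diagonal matrices in $\mathfrak{g}$, and $\epsilon_j\in\mathfrak{h}^*$ given by $\epsilon_j\begin{pmatrix} E_{k,k} & 0 \\ 0 & -E_{k,k} \end{pmatrix}=\delta_{j,k}$. The root system is $\Phi=\Phi^s\cup\Phi^\ell$ with short roots $\Phi^s=\{\pm(\epsilon_k\pm\epsilon_\ell)\}_{k\neq\ell}$ and long roots $\Phi^\ell=\{\pm2\epsilon_j\}_{j=1}^r$ (for $r=1$, $\Phi=\Phi^\ell$); $\Phi_+^s=\{\epsilon_j\pm\epsilon_k\mid 1\le j<k\le r\}$, $\Phi_+^\ell=\{2\epsilon_j\mid1\le j\le r\}$, $\Phi_+=\Phi_+^s\cup\Phi_+^\ell$. Simple roots: $\alpha_k=\epsilon_k-\epsilon_{k+1}$ ($1\le k<r$), $\alpha_r=2\epsilon_r$; highest root $\theta=2\epsilon_1$. Simple coroots: $h_j=\begin{pmatrix} E_{j,j}-E_{j+1,j+1} & 0 \\ 0 & -E_{j,j}+E_{j+1,j+1} \end{pmatrix}$ ($1\le j<r$), $h_r=\begin{pmatrix} E_{r,r} & 0 \\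 0 & -E_{r,r} \end{pmatrix}$. Root vectors, for $1\le k\ne\ell\le r$ and $1\le j\le r$: $$e_{\epsilon_k-\epsilon_\ell}=\begin{pmatrix} E_{k,\ell} & 0 \\ 0 & -E_{\ell,k} \end{pmatrix},\quad e_{\epsilon_k+\epsilon_\ell}=\begin{pmatrix} 0 & E_{k,\ell}+E_{\ell,k} \\ 0 & 0 \end{pmatrix},\quad e_{-\epsilon_k-\epsilon_\ell}=\begin{pmatrix} 0 & 0 \\ E_{k,\ell}+E_{\ell,k} & 0 \end{pmatrix},$$ $$e_{2\epsilon_j}=\begin{pmatrix} 0 & E_{j,j} \\ 0 & 0 \end{pmatrix},\quad e_{-2\epsilon_j}=\begin{pmatrix} 0 & 0 \\ E_{j,j} & 0 \end{pmatrix}.$$ Affine data: let $(\cdot,\cdot)$ be the invariant symmetric bilinear form on $\mathfrak{g}$ normalized so that long roots satisfy $(\alpha,\alpha)=2$ for the induced form on $\mathfrak{h}^*$ (so $(\epsilon_i,\epsilon_j)=\frac12\delta_{i,j}$). $\widetilde{\mathfrak{sp}}_r(\mathbb{C})=(\mathfrak{g}\otimes\mathbb{C}[t,t^{-1}])\oplus\mathbb{C}c\oplus\mathbb{C}d$ with, writing $x[k]:=x\otimes t^k$, $[x[k],y[m]]=[x,y][k+m]+k\delta_{k,-m}(x,y)c$, $c$ central, $[d,x[m]]=m\,x[m]$. The Chevalley involution satisfies $\widetilde\omega(x[k])=\omega(x)[-k]$, $\widetilde\omega(c)=-c$, $\widetilde\omega(d)=-d$, and $\widetilde{\mathfrak{k}}=\{x\mid\widetilde\omega(x)=x\}$.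 Let $\delta$ be the functional on $\mathfrak{h}\oplus\mathbb{C}c\oplus\mathbb{C}d$ with $\delta(d)=1$, $\delta(\mathfrak{h})=0=\delta(c)$. For $\alpha\in\Phi$, $k\in\mathbb{Z}$ put $$y_{\alpha+k\delta}:=e_\alpha[k]-e_{-\alpha}[-k],\qquad y_{k\delta}^{(i)}:=h_i[k]-h_i[-k]\quad(1\le i\le r),$$ so $y_{-\alpha-k\delta}=-y_{\alpha+k\delta}$ and $y_{-k\delta}^{(i)}=-y_{k\delta}^{(i)}$. The affine simple root is $\alpha_0=-2\epsilon_1+\delta$, and $Y_j:=y_{\alpha_j}$ for $0\le j\le r$ (so $Y_0=e_{-2\epsilon_1}[1]-e_{2\epsilon_1}[-1]$); these generate $\widetilde{\mathfrak{k}}$. A one-dimensional representation of $\widetilde{\mathfrak{k}}$ is a linear functional vanishing on $[\widetilde{\mathfrak{k}},\widetilde{\mathfrak{k}}]$; for each $s,t\in\mathbb{C}$ the representation $\chi_{s,t}$ exists and is unique, and these are all the one-dimensional representations of $\widetilde{\mathfrak{k}}$. *)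

(* Defs.v *)
From HB Require Import structures.
From mathcomp Require Import all_boot all_order all_algebra.
From mathcomp Require Import finmap mathcomp_extra boolp classical_sets functions.
From mathcomp Require Import cardinality fsbigop reals.
From mathcomp Require Import ring.

Set Implicit Arguments.
Unset Strict Implicit.
Unset Printing Implicit Defensive.

Import Order.TTheory GRing.Theory Num.Theory.
Local Open Scope ring_scope.
Local Open Scope classical_set_scope.

Section SpPred.
Variables (K : fieldType) (r : nat).

Definition sp_pred : {pred 'M[K]_(r + r)} := fun X =>
  [&& drsubmx X == - (ulsubmx X)^T,
      (ursubmx X)^T == ursubmx X & (dlsubmx X)^T == dlsubmx X].

Lemma sp_predP (X : 'M[K]_(r + r)) :
  reflect (exists B C D : 'M[K]_r,
             [/\ C^T = C, D^T = D & X = block_mx B C D (- B^T)])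
          (X \in sp_pred).
Proof.
apply: (iffP and3P) => [[/eqP e1 /eqP e2 /eqP e3]|[B [C [D [eC eD ->]]]]].
  exists (ulsubmx X), (ursubmx X), (dlsubmx X); split=> //.
  by rewrite -e1 submxK.
by rewrite block_mxKdr block_mxKul block_mxKur block_mxKdl eC eD.
Qed.

Lemma sp_pred_symplectic (X : 'M[K]_(r + r)) (J := block_mx 0 1%:M (- 1%:M) 0) :
  (X \in sp_pred) = (X *m J == - (J *m X^T)).
Proof.
rewrite -[X]submxK tr_block_mx !mulmx_block !(mulmx0, mul0mx, mulNmx, mulmxN).
rewrite !(mulmx1, mul1mx, add0r, addr0) opp_block_mx !opprK /in_mem/= /sp_pred.
rewrite block_mxKdr block_mxKul block_mxKur block_mxKdl.
apply/and3P/eqP => [[/eqP-> /eqP-> /eqP->]|/eq_block_mx[e1 e2 e3 e4]].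
  by rewrite [(- _)^T]linearN /= trmxK !opprK.
by split; rewrite -?e3 ?opprK ?[eqbRHS]e4 //; apply/eqP/oppr_inj; rewrite -e1.
Qed.

Fact sp_pred_submod : submod_closed sp_pred.
Proof.
split=> [|a X Y]; rewrite !sp_pred_symplectic.
  by rewrite mul0mx trmx0 mulmx0 oppr0.
move=> /eqP eX /eqP eY; rewrite linearP/= mulmxDl -scalemxAl eX eY.
by rewrite mulmxDr -scalemxAr scalerN opprD.
Qed.

HB.instance Definition _ :=
  GRing.isSubmodClosed.Build K 'M[K]_(r + r) sp_pred sp_pred_submod.

Record sp := Sp { sp_val :> 'M[K]_(r + r); _ : sp_val \in sp_pred }.

HB.instance Definition _ := [isSub for sp_val].
HB.instance Definition _ := [Choice of sp by <:].
HB.instance Definition _ := [SubChoice_isSubLmodule of sp by <:].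

Fact sp_br_subproof (X Y : sp) : X *m Y - Y *m X \in sp_pred.
Proof.
case: X Y => [X +] [Y +] /=; rewrite !sp_pred_symplectic => /eqP eX /eqP eY.
rewrite mulmxBl -!mulmxA eX eY !mulmxN !mulmxA eX eY !mulNmx !opprK -!mulmxA.
by rewrite linearB/= !trmx_mul mulmxBr opprB.
Qed.

Definition sp_br (X Y : sp) : sp := Sp (sp_br_subproof X Y).

Fact sp_omega_subproof (X : sp) : - X^T \in sp_pred.
Proof.
case: X => X /=; rewrite rpredN => /sp_predP[B [C [D [eC eD ->]]]].
apply/sp_predP; exists B^T, D, C.
by rewrite tr_block_mx linearN /= !trmxK eC eD.
Qed.

Definition sp_omega (X : sp) : sp := Sp (sp_omega_subproof X).

(* The normalized invariant form is the trace form of the standard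
   representation: see sp_form_sym, sp_form_invariant and sp_form_cartan. *)
Definition sp_form (X Y : sp) : K := \tr (X *m Y).

End SpPred.

Section SpForm.
Variables (K : fieldType) (r : nat).
Implicit Types X Y Z : sp K r.

Lemma sp_form_sym X Y : sp_form X Y = sp_form Y X.
Proof. exact: mxtrace_mulC. Qed.

Lemma sp_form_invariant X Y Z :
  sp_form (sp_br X Y) Z = sp_form X (sp_br Y Z).
Proof.
rewrite /sp_form /= mulmxBl mulmxBr !linearB /= !mulmxA; congr (_ - _).
by rewrite -[in LHS]mulmxA mxtrace_mulC.
Qed.

Lemma sp_form_omega X Y : sp_form (sp_omega X) (sp_omega Y) = sp_form X Y.
Proof.
by rewrite /sp_form /= mulmxN mulNmx opprK -trmx_mul mxtrace_tr mxtrace_mulC.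
Qed.

Lemma sp_br_omega X Y :
  sp_br (sp_omega X) (sp_omega Y) = sp_omega (sp_br X Y).
Proof.
apply: val_inj => /=; rewrite !mulmxN !mulNmx !opprK -!trmx_mul.
by rewrite [in RHS]linearB /= opprB.
Qed.

Lemma sp_br0 X : sp_br X 0 = 0.
Proof. by apply: val_inj; rewrite /= mulmx0 mul0mx subr0. Qed.

Lemma sp_0br X : sp_br 0 X = 0.
Proof. by apply: val_inj; rewrite /= mulmx0 mul0mx subr0. Qed.

Lemma sp_form0 X : sp_form X 0 = 0.
Proof. by rewrite /sp_form /= mulmx0 mxtrace0. Qed.

Lemma sp_0form X : sp_form 0 X = 0.
Proof. by rewrite /sp_form /= mul0mx mxtrace0. Qed.

Lemma sp_omega_linear : linear (@sp_omega K r).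
Proof.
by move=> a X Y; apply: val_inj; rewrite /= linearP /= opprD scalerN.
Qed.

HB.instance Definition _ :=
  GRing.isLinear.Build K (sp K r) (sp K r) _ (@sp_omega K r) sp_omega_linear.

Lemma sp_omegaK : involutive (@sp_omega K r).
Proof.
by move=> X; apply: val_inj; rewrite /= [(- _)^T]linearN /= trmxK opprK.
Qed.

End SpForm.

Section Roots.
Variables (K : fieldType) (r : nat).

Fact cartan_subproof (v : 'rV[K]_r) :
  block_mx (diag_mx v) 0 0 (- diag_mx v) \in @sp_pred K r.
Proof.
by apply/sp_predP; exists (diag_mx v), 0, 0; rewrite !trmx0 tr_diag_mx.
Qed.

Definition cartan (v : 'rV[K]_r) : sp K r := Sp (cartan_subproof v).

(* With H_j := cartan (delta_mx 0 j), this says that epsilon_j is represented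
   by H_j / 2, hence that (epsilon_i, epsilon_j) = delta_(i, j) / 2 and that
   the long roots +- 2 epsilon_j have square length 2. *)
Lemma sp_form_cartan (u v : 'rV[K]_r) :
  sp_form (cartan u) (cartan v) = 2 * \sum_j u 0 j * v 0 j.
Proof.
rewrite /sp_form /= mulmx_block !(mulmx0, mul0mx, addr0, add0r) mulmxN mulNmx.
rewrite opprK mxtrace_block -mulr2n mulr_natl; congr (_ *+ _).
by apply: eq_bigr => i _; rewrite mul_diag_mx !mxE eqxx.
Qed.

(* Elements of the root lattice are given by their integer coordinates in the
   basis epsilon_1, ..., epsilon_r; the index is shifted to start at 0. *)
Definition eps (j : 'I_r) : 'rV[int]_r := delta_mx 0 j.

Definition short_roots : set 'rV[int]_r :=
  [set a | exists k l : 'I_r, k != l /\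
     (a = eps k - eps l \/ a = eps k + eps l \/ a = - eps k - eps l)].

Definition long_pos_roots : set 'rV[int]_r :=
  [set a | exists j : 'I_r, a = eps j *+ 2].

Fact root_vector_subproof (a : 'rV[int]_r)
    (B : 'M[K]_r := \matrix_(k, l) ((k != l) && (a == eps k - eps l))%:R)
    (C : 'M[K]_r := \matrix_(k, l) (a == eps k + eps l)%:R)
    (D : 'M[K]_r := \matrix_(k, l) (a == - eps k - eps l)%:R) :
  block_mx B C D (- B^T) \in @sp_pred K r.
Proof.
apply/sp_predP; exists B, C, D; split=> //; apply/matrixP => k l.
  by rewrite !mxE addrC.
by rewrite !mxE addrC.
Qed.

(* e_alpha for a root alpha; see root_vector_sub etc. below for its values.
   It is 0 when alpha is not a root. *)
Definition root_vector (a : 'rV[int]_r) : sp K r := Sp (root_vector_subproof a).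

Lemma eps_add_eq (k l k' l' : 'I_r) :
  (eps k + eps l == eps k' + eps l') =
  ((k == k') && (l == l')) || ((k == l') && (l == k')).
Proof.
apply/eqP/orP => [e|[|]/andP[/eqP-> /eqP->] //]; last exact: addrC.
have := congr1 (fun a : 'rV_r => a 0 k) e; rewrite !mxE !eqxx /=.
have [kk'|_] := eqVneq k k'; [left|have [kl'|_] := eqVneq k l'; [right|]].
- by move: e; rewrite kk' => /addrI/rowP/(_ l); rewrite !mxE !eqxx /=; case: eqP.
- move: e; rewrite kl' [RHS]addrC => /addrI/rowP/(_ l).
  by rewrite !mxE !eqxx /=; case: eqP.
- by case: eqP.
Qed.

Definition height (a : 'rV[int]_r) : int := \sum_j a 0 j.

Lemma heightD a b : height (a + b) = height a + height b.
Proof. by rewrite -big_split; apply: eq_bigr => j _; rewrite mxE. Qed.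

Lemma heightN a : height (- a) = - height a.
Proof. by rewrite -sumrN; apply: eq_bigr => j _; rewrite mxE. Qed.

Lemma height_eps j : height (eps j) = 1.
Proof.
rewrite /height (bigD1 j) //= big1 => [|i ij]; first by rewrite mxE !eqxx.
by rewrite mxE (negPf ij).
Qed.

Let heightE := (heightD, heightN, height_eps).

Let eq_heightF a b : height a != height b -> (a == b) = false.
Proof. by move=> ne; apply/negbTE; apply: contra_neq ne => ->. Qed.

Lemma root_vector_sub (k l : 'I_r) : k != l ->
  root_vector (eps k - eps l) =
  block_mx (delta_mx k l) 0 0 (- delta_mx l k) :> 'M_(r + r).
Proof.
move=> kl; have e : (\matrix_(k', l') ((k' != l') &&
    (eps k - eps l == eps k' - eps l'))%:R : 'M[K]_r) = delta_mx k l.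
  apply/matrixP => k' l'; rewrite !mxE; congr (_%:R : K).
  rewrite subr_eq addrAC [eps k == _]eq_sym subr_eq eps_add_eq.
  rewrite [l == k]eq_sym (negPf kl) andbF orbF [l == l']eq_sym.
  have [->|//] := eqVneq k' l'; have [->|//] := eqVneq l' k.
  by rewrite (negPf kl).
rewrite /= e trmx_delta; congr block_mx; apply/matrixP => k' l'; rewrite !mxE;
  by rewrite eq_heightF // !heightE.
Qed.

Lemma root_vector_add (k l : 'I_r) : k != l ->
  root_vector (eps k + eps l) =
  block_mx 0 (delta_mx k l + delta_mx l k) 0 0 :> 'M_(r + r).
Proof.
move=> kl /=; congr block_mx; apply/matrixP => k' l'; rewrite !mxE.
- by rewrite eq_heightF ?andbF // !heightE.
- rewrite eps_add_eq -natrD; congr (_%:R : K).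
  rewrite ![k == _]eq_sym ![l == _]eq_sym.
  have [->|] := eqVneq k' k; have [->|] := eqVneq l' k => //=;
    by rewrite ?(negPf kl) ?andbF ?andbT ?orbF ?addn0.
- by rewrite eq_heightF // !heightE.
- by rewrite eq_heightF ?andbF ?oppr0 // !heightE.
Qed.

Lemma root_vector_opp (k l : 'I_r) : k != l ->
  root_vector (- eps k - eps l) =
  block_mx 0 0 (delta_mx k l + delta_mx l k) 0 :> 'M_(r + r).
Proof.
move=> kl /=; congr block_mx; apply/matrixP => k' l'; rewrite !mxE.
- by rewrite eq_heightF ?andbF // !heightE.
- by rewrite eq_heightF // !heightE.
- rewrite -!opprD eqr_opp eps_add_eq -natrD; congr (_%:R : K).
  rewrite ![k == _]eq_sym ![l == _]eq_sym.
  have [->|] := eqVneq k' k; have [->|] := eqVneq l' k => //=;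
    by rewrite ?(negPf kl) ?andbF ?andbT ?orbF ?addn0.
- by rewrite eq_heightF ?andbF ?oppr0 // !heightE.
Qed.

Lemma root_vector_long (j : 'I_r) :
  root_vector (eps j *+ 2) = block_mx 0 (delta_mx j j) 0 0 :> 'M_(r + r).
Proof.
rewrite mulr2n /=; congr block_mx; apply/matrixP => k' l'; rewrite !mxE.
- by rewrite eq_heightF ?andbF // !heightE.
- by rewrite eps_add_eq [(j == l') && _]andbC orbb ![j == _]eq_sym.
- by rewrite eq_heightF // !heightE.
- by rewrite eq_heightF ?andbF ?oppr0 // !heightE.
Qed.

Lemma root_vector_long_opp (j : 'I_r) :
  root_vector (- (eps j *+ 2)) = block_mx 0 0 (delta_mx j j) 0 :> 'M_(r + r).
Proof.
rewrite mulr2n /=; congr block_mx; apply/matrixP => k' l'; rewrite !mxE.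
- by rewrite eq_heightF ?andbF // !heightE.
- by rewrite eq_heightF // !heightE.
- rewrite -opprD eqr_opp eps_add_eq.
  by rewrite [(j == l') && _]andbC orbb ![j == _]eq_sym.
- by rewrite eq_heightF ?andbF ?oppr0 // !heightE.
Qed.

Lemma sp_br_cartan_root_vector (v : 'rV[K]_r) (a : 'rV[int]_r) :
  sp_br (cartan v) (root_vector a) =
  (\sum_j (a 0 j)%:~R * v 0 j) *: root_vector a.
Proof.
set c := \sum_j _.
have cD (b d : 'rV[int]_r) : \sum_j ((b + d) 0 j)%:~R * v 0 j =
    \sum_j (b 0 j)%:~R * v 0 j + \sum_j (d 0 j)%:~R * v 0 j.
  by rewrite -big_split; apply: eq_bigr => j _; rewrite mxE intrD mulrDl.
have cN (b : 'rV[int]_r) : \sum_j ((- b) 0 j)%:~R * v 0 j =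
    - \sum_j (b 0 j)%:~R * v 0 j.
  by rewrite -sumrN; apply: eq_bigr => j _; rewrite mxE mulrNz mulNr.
have ce k : \sum_j (eps k 0 j)%:~R * v 0 j = v 0 k.
  rewrite (bigD1 k) //= big1 => [|i ik].
    by rewrite mxE !eqxx mul1r addr0.
  by rewrite mxE (negPf ik) mul0r.
apply: val_inj => /=; rewrite !mulmx_block !(mul0mx, mulmx0, add0r, addr0).
rewrite opp_block_mx add_block_mx scale_block_mx.
congr block_mx; apply/matrixP => k l;
  rewrite ?mulmxN ?mulNmx ?mulmxN ?mul_diag_mx ?mul_mx_diag !mxE.
- case: (a =P _) => [e|_]; last by rewrite andbF /=; ring.
  by rewrite /c e cD cN !ce andbT; case: (_ != _) => /=; ring.
- case: (a =P _) => [e|_]; last by rewrite /=; ring.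
  by rewrite /c e cD !ce /=; ring.
- case: (a =P _) => [e|_]; last by rewrite /=; ring.
  by rewrite /c e cD !cN !ce /=; ring.
- case: (a =P _) => [e|_]; last by rewrite andbF /=; ring.
  by rewrite /c e cD cN !ce andbT; case: (_ != _) => /=; ring.
Qed.

Lemma sp_omega_root_vector (a : 'rV[int]_r) :
  sp_omega (root_vector a) = - root_vector (- a).
Proof.
apply: val_inj => /=; congr (- _); rewrite tr_block_mx.
congr block_mx; apply/matrixP => k l; rewrite !mxE.
- by rewrite eq_sym -[a == _]eqr_opp opprB.
- by rewrite -[a == _]eqr_opp opprD !opprK addrC.
- by rewrite -[a == _]eqr_opp opprD addrC.
- by congr (- _); rewrite eq_sym -[a == _]eqr_opp opprB.
Qed.

Lemma sp_omega_cartan (v : 'rV[K]_r) : sp_omega (cartan v) = - cartan v.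
Proof.
apply: val_inj => /=; congr (- _).
by rewrite tr_block_mx !trmx0 linearN /= tr_diag_mx.
Qed.

(* ordS is the (cyclic) successor; it is only used at i with i.+1 < r. *)
Definition simple_root (i : 'I_r) : 'rV[int]_r :=
  if i.+1 == r then eps i *+ 2 else eps i - eps (ordS i).

Definition simple_coroot (i : 'I_r) : sp K r :=
  if i.+1 == r then cartan (delta_mx 0 i)
  else cartan (delta_mx 0 i - delta_mx 0 (ordS i)).

Lemma sp_omega_simple_coroot (i : 'I_r) :
  sp_omega (simple_coroot i) = - simple_coroot i.
Proof. by rewrite /simple_coroot; case: ifP => _; exact: sp_omega_cartan. Qed.

End Roots.

Section Affine.
Variables (K : fieldType) (r : nat).

(* sp_r (x) K[t, t^-1]: x stands for \sum_k x k (x) t^k. *)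
Definition finsupp_pred : {pred int -> sp K r} :=
  fun x => `[< finite_set [set k | x k != 0] >].

Fact finsupp_pred_submod : submod_closed finsupp_pred.
Proof.
split=> [|a x y /asboolP finx /asboolP finy]; apply/asboolP.
  by apply: (sub_finite_set _ (finite_set0 int)) => k /eqP[].
have fin : finite_set ([set k | x k != 0] `|` [set k | y k != 0]).
  by rewrite finite_setU.
apply: sub_finite_set fin => k /=; apply: contraNP => /not_orP[].
move=> /negP/negPn/eqP ex /negP/negPn/eqP ey; apply/eqP.
by rewrite -[LHS]/(a *: x k + y k) ex ey scaler0 addr0.
Qed.

HB.instance Definition _ := GRing.isSubmodClosed.Build K (int -> sp K r)
  finsupp_pred finsupp_pred_submod.

Record loop := Loop { loop_val :> int -> sp K r; _ : loop_val \in finsupp_pred }.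

HB.instance Definition _ := [isSub for loop_val].
HB.instance Definition _ := [Choice of loop by <:].
HB.instance Definition _ := [SubChoice_isSubLmodule of loop by <:].

(* The triple (x, a, b) stands for x + a c + b d. *)
Definition affine : Type := (loop * K^o * K^o)%type.
HB.instance Definition _ := GRing.Lmodule.on affine.

Definition loop_part (u : affine) : loop := u.1.1.
Definition c_coef (u : affine) : K := u.1.2.
Definition d_coef (u : affine) : K := u.2.

Fact monomial_subproof (X : sp K r) (k : int) :
  (fun m => if m == k then X else 0) \in finsupp_pred.
Proof.
apply/asboolP; apply: sub_finite_set (finite_set1 k) => m /=.
by have [->//|_ /eqP[]] := eqVneq m k.
Qed.

(* X[k] = X (x) t^k *)
Definition monomial (X : sp K r) (k : int) : affine :=
  (Loop (monomial_subproof X k), 0, 0).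

Lemma monomialN X k : monomial (- X) k = - monomial X k.
Proof.
congr (_, _, _); rewrite ?oppr0 //; apply: val_inj; apply/funext => m /=.
by rewrite -[RHS]/(- (if m == k then X else 0)); case: ifP; rewrite ?oppr0.
Qed.

Definition central : affine := (0, 1, 0).
Definition derivation : affine := (0, 0, 1).

Definition loop_br_fun (u v : affine) (n : int) : sp K r :=
  \sum_(k \in [set: int]) sp_br (loop_part u k) (loop_part v (n - k))
  + (d_coef u * n%:~R) *: loop_part v n - (d_coef v * n%:~R) *: loop_part u n.

Fact loop_br_subproof (u v : affine) : loop_br_fun u v \in finsupp_pred.
Proof.
have fin (w : affine) : finite_set [set k | loop_part w k != 0].
  by case: w => [[[w /= /asboolP]]].
apply/asboolP; have := finite_image2 (fun i j => i + j) (fin u) (fin v).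
set S := [set _ | _ in _ & _ in _] => finS.
have : finite_set (S `|` [set k | loop_part u k != 0]
                     `|` [set k | loop_part v k != 0]).
  by rewrite !finite_setU.
apply: sub_finite_set => n /=; apply: contraNP => /not_orP[/not_orP[nS]].
move=> /negP/negPn/eqP un /negP/negPn/eqP vn; apply/eqP.
rewrite /loop_br_fun un vn !scaler0 subr0 addr0; apply: fsbig1 => k _.
have [->|uk] := eqVneq (loop_part u k) 0; first exact: sp_0br.
have [->|vk] := eqVneq (loop_part v (n - k)) 0; first exact: sp_br0.
by case: nS; exists k => //; exists (n - k) => //; rewrite addrC subrK.
Qed.

Definition affine_br (u v : affine) : affine :=
  (Loop (loop_br_subproof u v),
   \sum_(k \in [set: int]) k%:~R * sp_form (loop_part u k) (loop_part v (- k)),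
   0).

Lemma affine_br_monomial X Y k m :
  affine_br (monomial X k) (monomial Y m) =
  monomial (sp_br X Y) (k + m)
  + (if k == - m then k%:~R * sp_form X Y else 0) *: central.
Proof.
have sum1 (V : nmodType) (F : int -> V) :
    (forall j, j != k -> F j = 0) -> \sum_(j \in [set: int]) F j = F k.
  move=> F0; rewrite -(fsbig_widen [set k]) ?fsbig_set1// => j [_ /eqP jk].
  exact: F0.
congr (_, _, _); rewrite /= ?scaler0 ?addr0 //.
  apply: val_inj; apply/funext => n /=.
  rewrite /loop_br_fun /= !mul0r !scale0r subr0 addr0 sum1 => [|j jk].
    rewrite eqxx subr_eq [m + k]addrC.
    by case: eqP => // _; rewrite sp_br0.
  by rewrite (negPf jk) sp_0br.
rewrite add0r sum1 => [|j jk]; last by rewrite (negPf jk) sp_0form mulr0.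
rewrite eqxx eqr_oppLR; case: eqP => _; first by rewrite /GRing.scale /= mulr1.
by rewrite sp_form0 mulr0 scale0r.
Qed.

Lemma affine_br_derivation X m :
  affine_br derivation (monomial X m) = m%:~R *: monomial X m.
Proof.
congr (_, _, _); rewrite /= ?scaler0 //; last first.
  by apply: fsbig1 => k _; rewrite sp_0form mulr0.
apply: val_inj; apply/funext => n.
rewrite -[RHS]/(m%:~R *: (if n == m then X else 0)) /= /loop_br_fun /=.
rewrite fsbig1 => [|k _]; last exact: sp_0br.
rewrite add0r mul1r mul0r scale0r subr0.
by case: eqP => [->|]; rewrite ?scaler0.
Qed.

Lemma affine_br_centrall u : affine_br central u = 0.
Proof.
congr (_, _, _); last by apply: fsbig1 => k _; rewrite sp_0form mulr0.
apply: val_inj; apply/funext => n /=; rewrite /loop_br_fun /=.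
rewrite fsbig1 => [|k _]; last exact: sp_0br.
by rewrite mul0r scale0r scaler0 add0r subr0.
Qed.

Lemma affine_br_centralr u : affine_br u central = 0.
Proof.
congr (_, _, _); last by apply: fsbig1 => k _; rewrite sp_form0 mulr0.
apply: val_inj; apply/funext => n /=; rewrite /loop_br_fun /=.
rewrite fsbig1 => [|k _]; last exact: sp_br0.
by rewrite mul0r scale0r scaler0 add0r subr0.
Qed.

Fact affine_omega_subproof (u : affine) :
  (fun k => sp_omega (loop_part u (- k))) \in finsupp_pred.
Proof.
case: u => [[[x /= /asboolP finx] _] _] /=; apply/asboolP.
apply: sub_finite_set (finite_image -%R finx) => k /= nz.
exists (- k); rewrite ?opprK//; apply: contra_neq nz => ->.
by rewrite linear0.
Qed.

Definition affine_omega (u : affine) : affine :=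
  (Loop (affine_omega_subproof u), - c_coef u, - d_coef u).

Lemma affine_omega_monomial X k :
  affine_omega (monomial X k) = monomial (sp_omega X) (- k).
Proof.
congr (_, _, _); rewrite /c_coef/d_coef/= ?oppr0//.
apply: val_inj; apply/funext => m /=.
by rewrite -eqr_oppLR; case: ifP => // _; rewrite linear0.
Qed.

Definition ktilde_pred : {pred affine} := fun u => affine_omega u == u.

Fact affine_omega_linear : linear affine_omega.
Proof.
move=> a u v; congr (_, _, _); rewrite /c_coef/d_coef/= ?opprD ?scalerN//.
by apply: val_inj; apply/funext => k; rewrite /= linearP.
Qed.

HB.instance Definition _ := GRing.isLinear.Build K affine affine _
  affine_omega affine_omega_linear.

Fact ktilde_pred_submod : submod_closed ktilde_pred.
Proof.
split=> [|a u v /eqP eu /eqP ev]; apply/eqP; first by rewrite linear0.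
by rewrite linearP /= eu ev.
Qed.

HB.instance Definition _ := GRing.isSubmodClosed.Build K affine
  ktilde_pred ktilde_pred_submod.

Record ktilde := Ktilde { ktilde_val :> affine; _ : ktilde_val \in ktilde_pred }.

HB.instance Definition _ := [isSub for ktilde_val].
HB.instance Definition _ := [Choice of ktilde by <:].
HB.instance Definition _ := [SubChoice_isSubLmodule of ktilde by <:].

Lemma affine_omega_br u v :
  affine_omega (affine_br u v) = affine_br (affine_omega u) (affine_omega v).
Proof.
have fsumE (V W : zmodType) (f : {additive V -> W}) (F : int -> V) :
    injective f ->
    f (\sum_(k \in [set: int]) F k) = \sum_(k \in [set: int]) f (F k).
  move=> f_inj; rewrite raddf_sum /finite_support.
  rewrite (_ : _ `&` F @^-1` _ =
    [set: int] `&` (fun k => f (F k)) @^-1` [set~ 0]) //.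
  by apply/seteqP; split=> k [_ /= nz]; split=> //= fk0; apply: nz;
    rewrite ?fk0 ?raddf0 //; apply: f_inj; rewrite fk0 raddf0.
have oppP : set_bij [set: int] [set: int] -%R.
  by split=> [//|? ? _ _ /oppr_inj //|k _]; exists (- k); rewrite ?opprK.
congr (_, _, _); rewrite /= ?oppr0 //.
  apply: val_inj; apply/funext => n /=; rewrite /loop_br_fun /=.
  rewrite linearB linearD !linearZ /= !mulNr mulrNz !mulrN.
  congr (_ + _ + _).
  rewrite fsumE; last exact: inv_inj (@sp_omegaK K r).
  rewrite (reindex_fsbig _ _ _ _ oppP); apply: eq_fsbigr => k _ /=.
  by rewrite sp_br_omega opprB opprK addrC.
rewrite fsumE; last exact: oppr_inj.
rewrite (reindex_fsbig _ _ _ _ oppP); apply: eq_fsbigr => k _ /=.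
by rewrite sp_form_omega mulrNz mulNr !opprK.
Qed.

Fact ktilde_br_subproof (x y : ktilde) : affine_br x y \in ktilde_pred.
Proof.
case: x y => [x /= /eqP ex] [y /= /eqP ey]; apply/eqP.
by rewrite affine_omega_br ex ey.
Qed.

Definition ktilde_br (x y : ktilde) : ktilde := Ktilde (ktilde_br_subproof x y).

Definition one_dim_rep (chi : {linear ktilde -> K^o}) : Prop :=
  forall x y : ktilde, chi (ktilde_br x y) = 0.

Fact y_real_subproof (a : 'rV[int]_r) (k : int) :
  monomial (root_vector K a) k - monomial (root_vector K (- a)) (- k)
    \in ktilde_pred.
Proof.
apply/eqP; rewrite linearB /= !affine_omega_monomial !sp_omega_root_vector.
by rewrite !opprK !monomialN opprK addrC.
Qed.

(* y_(alpha + k delta) *)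
Definition y_real (a : 'rV[int]_r) (k : int) : ktilde :=
  Ktilde (y_real_subproof a k).

Fact y_imag_subproof (i : 'I_r) (k : int) :
  monomial (simple_coroot K i) k - monomial (simple_coroot K i) (- k)
    \in ktilde_pred.
Proof.
apply/eqP; rewrite linearB /= !affine_omega_monomial.
by rewrite !sp_omega_simple_coroot opprK !monomialN opprK addrC.
Qed.

(* y_(k delta)^(i) *)
Definition y_imag (i : 'I_r) (k : int) : ktilde :=
  Ktilde (y_imag_subproof i k).

Definition Y (i : 'I_r) : ktilde := y_real (simple_root i) 0.

(* alpha_0 = - 2 epsilon_1 + delta *)
Definition Y0 (r_gt0 : (0 < r)%N) : ktilde :=
  y_real (- (eps (Ordinal r_gt0) *+ 2)) 1.

End Affine.

Arguments Y0 {K r}.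
Arguments Y {K r}.
Arguments y_real {K r}.
Arguments y_imag {K r}.

(* Main.v *)
(* Write y(X, k) = X[k] + omega(X)[-k].  Then
     [y(X, k), y(Y, m)] = y([X, Y], k + m) + y([X, omega Y], k - m),
   so a one-dimensional representation chi satisfies
     chi(y([X, Y], k + m)) = - chi(y([X, omega Y], k - m)).
   Choosing X and Y with [X, omega Y] = 0 gives the vanishing on short root and
   imaginary elements; X in the Cartan subalgebra shows that on a long root only
   the parity of k matters; X = e_(eps_i - eps_j), Y = e_(eps_i + eps_j) identifies
   the values on 2 eps_i and 2 eps_j. *)
Require Import Defs.
From mathcomp Require Import all_boot all_order all_algebra.
From mathcomp Require Import classical_sets boolp cardinality fsbigop.
From mathcomp Require Import reals complex ring.

Set Implicit Arguments.
Unset Strict Implicit.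
Unset Printing Implicit Defensive.

Import Order.TTheory GRing.Theory Num.Theory.
Local Open Scope ring_scope.

(** A sum with infinite support is 0 by convention, so additivity can fail; [A] is a common finite
    bound for both supports. *)
Lemma fsumD (I : choiceType) (V : nmodType) (A : set I) (F G : I -> V) :
  finite_set A -> (forall i, ~ A i -> F i = 0) -> (forall i, ~ A i -> G i = 0) ->
  \sum_(i \in [set: I]) (F i + G i) =
  \sum_(i \in [set: I]) F i + \sum_(i \in [set: I]) G i.
Proof.
move=> finA F0 G0.
have widen (H : I -> V) : (forall i, ~ A i -> H i = 0) ->
    \sum_(i \in [set: I]) H i = \sum_(i \in A) H i.
  by move=> H0; rewrite -(fsbig_widen A) // => i [_ /H0].
rewrite !widen ?fsbig_split //.
by move=> i Ai; rewrite F0 ?G0 ?addr0.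
Qed.

(** Serves to cancel the factor 2 in the relations between values on long roots. *)
Lemma double_inj (K : fieldType) : (2 : K) != 0 -> injective (fun x : K => x + x).
Proof.
move=> two_neq0 x y exy; apply: (mulfI two_neq0).
by rewrite [2 * x]mulr_natl [2 * y]mulr_natl.
Qed.

(** * Biadditivity of the brackets on g and on the affine algebra *)

Section Brackets.
Variables (K : fieldType) (r : nat).
Implicit Types (X Y Z : sp K r) (u v w : affine K r).

Lemma sp_brDl X Y Z : sp_br (X + Y) Z = sp_br X Z + sp_br Y Z.
Proof. by apply: val_inj; rewrite /= mulmxDl mulmxDr opprD addrACA. Qed.

Lemma sp_brDr X Y Z : sp_br X (Y + Z) = sp_br X Y + sp_br X Z.
Proof. by apply: val_inj; rewrite /= mulmxDl mulmxDr opprD addrACA. Qed.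

Lemma sp_brNr X Y : sp_br X (- Y) = - sp_br X Y.
Proof. by apply: val_inj; rewrite /= mulmxN mulNmx opprD. Qed.

Lemma sp_brC X Y : sp_br X Y = - sp_br Y X.
Proof. by apply: val_inj; rewrite /= opprB. Qed.

Lemma sp_br_self X : sp_br X X = 0.
Proof. by apply: val_inj; rewrite /= subrr. Qed.

Lemma sp_brNl X Y : sp_br (- X) Y = - sp_br X Y.
Proof. by rewrite sp_brC sp_brNr -sp_brC. Qed.

Lemma sp_formDl X Y Z : sp_form (X + Y) Z = sp_form X Z + sp_form Y Z.
Proof. by rewrite /sp_form mulmxDl linearD. Qed.

Lemma sp_formDr X Y Z : sp_form X (Y + Z) = sp_form X Y + sp_form X Z.
Proof. by rewrite /sp_form mulmxDr linearD. Qed.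

Lemma finite_loop_part u : finite_set [set k | loop_part u k != 0].
Proof. by case: u => [[[x /= /asboolP]]]. Qed.

Lemma loop_part_out u k :
  ~ [set k | loop_part u k != 0]%classic k -> loop_part u k = 0.
Proof. by move=> /negP/negPn/eqP. Qed.

Lemma affine_brDl u v w :
  affine_br (u + v) w = affine_br u w + affine_br v w.
Proof.
(* The left argument varies, so the finite set must contain the supports of both [u] and [v]. *)
pose A := ([set k | loop_part u k != 0] `|` [set k | loop_part v k != 0])%classic.
have finA : finite_set A by rewrite finite_setU; split; exact: finite_loop_part.
have u0 k : ~ A k -> loop_part u k = 0 by move=> /not_orP[/loop_part_out].
have v0 k : ~ A k -> loop_part v k = 0 by move=> /not_orP[_ /loop_part_out].
congr (_, _, _); rewrite /= ?addr0 //.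
  apply: val_inj; apply/funext => n.
  rewrite -[RHS]/(loop_br_fun u w n + loop_br_fun v w n) /= /loop_br_fun.
  under eq_fsbigr do rewrite sp_brDl.
  rewrite (fsumD finA) => [|k /u0/= ->|k /v0/= ->]; rewrite ?sp_0br //.
  rewrite -[d_coef (u + v)]/(d_coef u + d_coef v).
  rewrite -[loop_part (u + v) n]/(loop_part u n + loop_part v n).
  rewrite mulrDl scalerDl scalerDr opprD.
  by rewrite [X in X + _]addrACA [LHS]addrACA.
under eq_fsbigr do rewrite sp_formDl mulrDr.
by rewrite (fsumD finA) // => k; [move=> /u0/= -> | move=> /v0/= ->];
  rewrite sp_0form mulr0.
Qed.

Lemma affine_brDr u v w :
  affine_br u (v + w) = affine_br u v + affine_br u w.
Proof.
(* Every term contains [loop_part u k], so the support of [u] alone bounds both sums. *)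
have finA := finite_loop_part u.
congr (_, _, _); rewrite /= ?addr0 //.
  apply: val_inj; apply/funext => n.
  rewrite -[RHS]/(loop_br_fun u v n + loop_br_fun u w n) /= /loop_br_fun.
  under eq_fsbigr do rewrite sp_brDr.
  rewrite (fsumD finA); try by move=> k /loop_part_out/= ->; rewrite sp_0br.
  rewrite -[d_coef (v + w)]/(d_coef v + d_coef w).
  rewrite -[loop_part (v + w) n]/(loop_part v n + loop_part w n).
  rewrite mulrDl scalerDl scalerDr opprD.
  by rewrite [X in X + _]addrACA [LHS]addrACA.
under eq_fsbigr do rewrite sp_formDr mulrDr.
by rewrite (fsumD finA) // => k /loop_part_out/= ->; rewrite sp_0form mulr0.
Qed.

Lemma monomialD X Y k : monomial (X + Y) k = monomial X k + monomial Y k.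
Proof.
congr (_, _, _); rewrite ?addr0 //; apply: val_inj; apply/funext => m /=.
rewrite -[RHS]/((if m == k then X else 0) + (if m == k then Y else 0)).
by case: ifP; rewrite ?addr0.
Qed.

End Brackets.

(** * The fixed elements y(X, k) and their brackets *)

Section FixedElements.
Variables (K : fieldType) (r : nat).
Implicit Types (X Y Z : sp K r) (k m : int).

Fact fixed_monomial_subproof X k :
  monomial X k + monomial (sp_omega X) (- k) \in @ktilde_pred K r.
Proof.
apply/eqP; rewrite linearD /= !affine_omega_monomial.
by rewrite sp_omegaK opprK addrC.
Qed.

(** This is y(X, k). Allowing every [X] in g puts [y_real] and [y_imag] under one bracket
    formula. *)
Definition fixed_monomial X k : ktilde K r := Ktilde (fixed_monomial_subproof X k).

Lemma fixed_monomialD X Y k :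
  fixed_monomial (X + Y) k = fixed_monomial X k + fixed_monomial Y k.
Proof. by apply: val_inj; rewrite /= linearD !monomialD addrACA. Qed.

Lemma fixed_monomialN X k : fixed_monomial (- X) k = - fixed_monomial X k.
Proof. by apply: val_inj; rewrite /= linearN !monomialN opprD. Qed.

Lemma fixed_monomial_omega X k :
  fixed_monomial (sp_omega X) (- k) = fixed_monomial X k.
Proof. by apply: val_inj; rewrite /= sp_omegaK opprK addrC. Qed.

(* The central terms cancel because the Chevalley involution fixes the
   invariant form on g and negates c. *)
Lemma ktilde_br_fixed_monomial X Y k m :
  ktilde_br (fixed_monomial X k) (fixed_monomial Y m) =
  fixed_monomial (sp_br X Y) (k + m) + fixed_monomial (sp_br X (sp_omega Y)) (k - m).
Proof.
apply: val_inj => /=; rewrite affine_brDl !affine_brDr !affine_br_monomial.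
rewrite -!sp_br_omega sp_omegaK !opprK sp_form_omega opprB opprD.
(* The conditions on the four central terms become [k == - m] and [k == m], each occurring twice
   with opposite coefficients. *)
rewrite eqr_opp eqr_oppLR -[sp_form (sp_omega X) Y]sp_form_omega sp_omegaK.
rewrite [- k + m]addrC mulrNz !mulNr.
have N (b : bool) (z : K) : (if b then - z else 0) = - (if b then z else 0).
  by case: b; rewrite ?oppr0.
rewrite !N !scaleNr.
set a := monomial _ _; set b := monomial _ _; set c := monomial _ _.
set d := monomial _ _; set e := _ *: _; set f := _ *: _.
rewrite [a + e + _]addrACA [c - f + _]addrACA [LHS]addrACA -opprD [f + e]addrC.
by rewrite subrr addr0 [c + d]addrC addrACA.
Qed.

Lemma y_realE a k : y_real a k = fixed_monomial (root_vector K a) k.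
Proof. by apply: val_inj; rewrite /= sp_omega_root_vector monomialN. Qed.

Lemma y_imagE i k : y_imag i k = fixed_monomial (simple_coroot K i) k.
Proof. by apply: val_inj; rewrite /= sp_omega_simple_coroot monomialN. Qed.

Lemma y_realN a k : y_real (- a) k = - y_real a (- k) :> ktilde K r.
Proof.
rewrite !y_realE -fixed_monomial_omega sp_omega_root_vector opprK.
by rewrite fixed_monomialN.
Qed.

End FixedElements.

(** * Brackets of root vectors and coroots in g *)

Section RootBrackets.
Variables (K : fieldType) (r : nat).
Implicit Types (X Y Z : sp K r) (i j : 'I_r).
Local Notation e a := (root_vector K a).

Lemma sp_val_br X Y : sp_val (sp_br X Y) = X *m Y - Y *m X.
Proof. by []. Qed.

Lemma cartanB v w : cartan (v - w) = cartan v - cartan w :> sp K r.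
Proof.
apply: (val_inj : injective (@sp_val K r)).
rewrite -[RHS]/(sp_val _ - sp_val _) /= opp_block_mx add_block_mx.
by rewrite !oppr0 !addr0 linearB opprD.
Qed.

Lemma diag_mx_delta j : diag_mx (delta_mx 0 j) = delta_mx j j :> 'M[K]_r.
Proof.
apply/matrixP => k l; rewrite !mxE eqxx /=.
have [->|kl] := eqVneq k l; first by rewrite andbb.
by case: eqP => //= <-; rewrite eq_sym (negPf kl).
Qed.

Lemma br_long_opp j :
  sp_br (e (eps j *+ 2)) (e (- (eps j *+ 2))) = cartan (delta_mx 0 j).
Proof.
apply: (val_inj : injective (@sp_val K r)).
rewrite sp_val_br root_vector_long root_vector_long_opp !mulmx_block.
rewrite !(mul0mx, mulmx0, addr0, add0r, mul_delta_mx) opp_block_mx add_block_mx.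
by rewrite !oppr0 !addr0 add0r /= diag_mx_delta.
Qed.

Lemma br_sub_long i j : i != j ->
  sp_br (e (eps i - eps j)) (e (eps j *+ 2)) = e (eps i + eps j).
Proof.
move=> ij; apply: (val_inj : injective (@sp_val K r)).
rewrite sp_val_br root_vector_sub // root_vector_long root_vector_add //.
rewrite !mulmx_block !(mul0mx, mulmx0, mulNmx, mulmxN, addr0, add0r, mul_delta_mx).
by rewrite opp_block_mx add_block_mx !oppr0 opprK !add0r.
Qed.

(** The weight would be [eps i - eps j *+ 3], which is not a root. *)
Lemma br_sub_long_opp i j : i != j ->
  sp_br (e (eps i - eps j)) (e (- (eps j *+ 2))) = 0.
Proof.
move=> ij; have ji : j != i by rewrite eq_sym.
apply: (val_inj : injective (@sp_val K r)).
rewrite sp_val_br root_vector_sub // root_vector_long_opp.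
rewrite !mulmx_block !(mul0mx, mulmx0, mulNmx, mulmxN, addr0, add0r).
by rewrite !mul_delta_mx_0 // oppr0 subrr.
Qed.

Lemma br_long_sub i j : i != j ->
  sp_br (e (eps i *+ 2)) (e (- eps i - eps j)) = e (eps i - eps j).
Proof.
move=> ij; apply: (val_inj : injective (@sp_val K r)).
rewrite sp_val_br root_vector_sub // root_vector_long root_vector_opp //.
rewrite !mulmx_block !(mul0mx, mulmx0, addr0, add0r) mulmxDl mulmxDr.
rewrite !mul_delta_mx !mul_delta_mx_0 // ?[j == i]eq_sym // addr0 add0r.
by rewrite opp_block_mx add_block_mx !oppr0 !addr0 add0r.
Qed.

(** The weight would be [eps i *+ 3 + eps j], which is not a root. *)
Lemma br_long_add i j : i != j ->
  sp_br (e (eps i *+ 2)) (e (eps i + eps j)) = 0.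
Proof.
move=> ij; apply: (val_inj : injective (@sp_val K r)).
rewrite sp_val_br root_vector_long root_vector_add //.
by rewrite !mulmx_block !(mul0mx, mulmx0, addr0, add0r) subrr.
Qed.

(** With [br_sub_opp], this links two distinct long roots. The coefficient 2 is written as a sum so
    that [fixed_monomialD] applies. *)
Lemma br_sub_add i j : i != j ->
  sp_br (e (eps i - eps j)) (e (eps i + eps j)) = e (eps i *+ 2) + e (eps i *+ 2).
Proof.
move=> ij; have ji : j != i by rewrite eq_sym.
apply: (val_inj : injective (@sp_val K r)).
rewrite sp_val_br -[RHS]/(sp_val _ + sp_val _).
rewrite root_vector_sub // root_vector_long root_vector_add //.
rewrite !mulmx_block !(mul0mx, mulmx0, mulNmx, mulmxN, addr0, add0r).
rewrite mulmxDl mulmxDr !mul_delta_mx !mul_delta_mx_0 // addr0 add0r.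
by rewrite opp_block_mx !add_block_mx !oppr0 !addr0 opprK ?add0r.
Qed.

Lemma br_sub_opp i j : i != j ->
  sp_br (e (eps i - eps j)) (e (- eps i - eps j)) =
  - (e (- (eps j *+ 2)) + e (- (eps j *+ 2))).
Proof.
move=> ij; have ji : j != i by rewrite eq_sym.
apply: (val_inj : injective (@sp_val K r)).
rewrite sp_val_br -[RHS]/(- (sp_val _ + sp_val _)).
rewrite root_vector_sub // root_vector_long_opp root_vector_opp //.
rewrite !mulmx_block !(mul0mx, mulmx0, mulNmx, mulmxN, addr0, add0r).
rewrite mulmxDl mulmxDr !mul_delta_mx !mul_delta_mx_0 // addr0 add0r.
by rewrite !(opp_block_mx, add_block_mx) !(addr0, oppr0, opprD).
Qed.

Lemma br_cartan_long i :
  sp_br (cartan (delta_mx 0 i)) (e (eps i *+ 2)) = e (eps i *+ 2) + e (eps i *+ 2).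
Proof.
rewrite sp_br_cartan_root_vector (bigD1 i) //= big1 => [|j ji]; last first.
  by rewrite mulmxnE !mxE (negPf ji) mulr0.
by rewrite mulmxnE !mxE !eqxx addr0 mulr1 -[RHS]mulr2n -[RHS]scaler_nat.
Qed.

Lemma br_cartan_long_opp i :
  sp_br (cartan (delta_mx 0 i)) (e (- (eps i *+ 2))) =
  - (e (- (eps i *+ 2)) + e (- (eps i *+ 2))).
Proof.
(* The Chevalley involution carries the relation for the positive root to the negative one. *)
have := congr1 (@sp_omega K r) (br_cartan_long i).
rewrite -sp_br_omega sp_omega_cartan linearD /= sp_omega_root_vector.
by rewrite sp_brNl sp_brNr opprK -opprD.
Qed.

End RootBrackets.

(** * Values of a one-dimensional representation on the y(X, k) *)

Section OneDimRep.
Variables (K : fieldType) (r : nat) (chi : {linear ktilde K r -> K^o}).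
Hypothesis chi_rep : one_dim_rep chi.
Hypothesis two_neq0 : (2 : K) != 0.
Implicit Types (X Y Z : sp K r) (i j : 'I_r) (k m : int).
Local Notation e a := (root_vector K a).
Local Notation f X k := (chi (fixed_monomial X k)).

Lemma chi_br X Y k m :
  f (sp_br X Y) (k + m) = - f (sp_br X (sp_omega Y)) (k - m).
Proof.
by apply/eqP; rewrite -addr_eq0 -linearD -ktilde_br_fixed_monomial chi_rep.
Qed.

Lemma chi0 k : f 0 k = 0.
Proof. by rewrite -[0]subr0 fixed_monomialD fixed_monomialN subrr linear0. Qed.

Lemma chiD X Y k : f (X + Y) k = f X k + f Y k.
Proof. by rewrite fixed_monomialD linearD. Qed.

Lemma chiN X k : f (- X) k = - f X k.
Proof. by rewrite fixed_monomialN linearN. Qed.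

Lemma chi_y_realN a k : chi (y_real (- a) k) = - chi (y_real a (- k)).
Proof. by rewrite y_realN linearN. Qed.

(** The coroot is [e, e'] with e, e' the root vectors of 2 eps_i and -2 eps_i. As omega(e') = -e,
    the other term of [chi_br] is [e, -e] = 0. *)
Lemma chi_coroot i k : f (cartan (delta_mx 0 i)) k = 0.
Proof.
rewrite -br_long_opp -[k]addr0 chi_br sp_omega_root_vector opprK sp_brNr.
by rewrite sp_br_self oppr0 chi0 oppr0.
Qed.

(* Bracketing with the coroot of [eps i *+ 2] shows that the value depends on
   the degree modulo 2 only. *)
Lemma chi_long_shift i k m :
  chi (y_real (eps i *+ 2) (k + m)) = chi (y_real (eps i *+ 2) (m - k)).
Proof.
have := chi_br (cartan (delta_mx 0 i)) (e (eps i *+ 2)) k m.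
rewrite sp_omega_root_vector sp_brNr br_cartan_long br_cartan_long_opp opprK.
(* The negative root in degree [k - m] becomes the positive one in degree [m - k], and the sign
   cancels that of [chi_br]. *)
rewrite !chiD -!y_realE chi_y_realN (opprB k m) opprD !opprK.
exact: double_inj two_neq0 _ _.
Qed.

Lemma chi_long_parity i k m :
  chi (y_real (eps i *+ 2) (2 * k + m)) = chi (y_real (eps i *+ 2) m).
Proof.
have -> : 2 * k + m = k + (k + m) by ring.
by rewrite chi_long_shift addrC addKr.
Qed.

Lemma chi_long_eq i j k :
  chi (y_real (eps i *+ 2) k) = chi (y_real (eps j *+ 2) k).
Proof.
have [->//|ij] := eqVneq i j.
(* With degrees 0 and [k], the other term sits at -2 eps_j in degree [- k], which reflects to 2
   eps_j in degree [k]. *)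
have := chi_br (e (eps i - eps j)) (e (eps i + eps j)) 0 k.
rewrite sp_omega_root_vector sp_brNr opprD br_sub_add // br_sub_opp // opprK.
rewrite !chiD -!y_realE chi_y_realN add0r sub0r opprK opprD !opprK.
exact: double_inj two_neq0 _ _.
Qed.

(** The other term of [chi_br] vanishes by [br_sub_long_opp]. *)
Lemma chi_add i j k : i != j -> chi (y_real (eps i + eps j) k) = 0.
Proof.
move=> ij; rewrite y_realE -br_sub_long // -[k]addr0 chi_br.
by rewrite sp_omega_root_vector sp_brNr br_sub_long_opp // !oppr0 chi0 oppr0.
Qed.

(** The other term of [chi_br] vanishes by [br_long_add]. *)
Lemma chi_sub i j k : i != j -> chi (y_real (eps i - eps j) k) = 0.
Proof.
move=> ij; rewrite y_realE -br_long_sub // -[k]addr0 chi_br.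
rewrite sp_omega_root_vector sp_brNr opprB opprK addrC.
by rewrite br_long_add // !oppr0 chi0 oppr0.
Qed.

Lemma chi_short a k : short_roots a -> chi (y_real a k) = 0.
Proof.
move=> [i [j [ij [->|[->|->]]]]]; [exact: chi_sub|exact: chi_add|].
by rewrite -opprD chi_y_realN chi_add // oppr0.
Qed.

(** A simple coroot is a long root's coroot or a difference of two such. *)
Lemma chi_imag i k : chi (y_imag i k) = 0.
Proof.
rewrite y_imagE /simple_coroot; case: ifP => _; first exact: chi_coroot.
by rewrite cartanB chiD chiN !chi_coroot subrr.
Qed.

End OneDimRep.

Theorem proposition4p4 (R : realType) (r : nat) (r_gt0 : (0 < r)%N)
    (s t : R[i]) (chi : {linear ktilde R[i] r -> R[i]^o}) :
  one_dim_rep chi ->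
  chi (Y0 r_gt0) = s ->
  (forall i : 'I_r, (i.+1 < r)%N -> chi (Y i) = 0) ->
  (forall i : 'I_r, i.+1 = r -> chi (Y i) = t) ->
  [/\ (forall (a : 'rV[int]_r) (k : int), long_pos_roots a ->
         chi (y_real a (2 * k)) = t /\ chi (y_real (- a) (2 * k)) = - t),
      (forall (a : 'rV[int]_r) (k : int), long_pos_roots a ->
         chi (y_real (- a) (2 * k + 1)) = s /\
         chi (y_real a (2 * k + 1)) = - s),
      (forall (a : 'rV[int]_r) (k : int), short_roots a ->
         chi (y_real a k) = 0) &
      (forall (k : int) (i : 'I_r), k != 0 -> chi (y_imag i k) = 0)].
Proof.
move=> rep chi_s _ chi_t.
have two_neq0 : (2 : R[i]) != 0 by rewrite pnatr_eq0.
have even_t j k : chi (y_real (eps j *+ 2) (2 * k)) = t.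
  (* Indices start at 0, so Y_r sits at [r.-1], where the simple root is long. *)
  have last_lt : (r.-1 < r)%N by rewrite prednK.
  have last_eq : (Ordinal last_lt).+1 = r by exact: prednK.
  rewrite -(chi_t _ last_eq) /Y /simple_root last_eq eqxx -[2 * k]addr0.
  by rewrite chi_long_parity //; exact: chi_long_eq.
have odd_s j k : chi (y_real (eps j *+ 2) (2 * k + 1)) = - s.
  (* The remainder is -1 because [Y0] is minus the element of 2 eps_1 in degree -1; hence the value
     [- s]. *)
  have -> : 2 * k + 1 = 2 * (k + 1) + (- 1) by ring.
  rewrite (chi_long_parity rep two_neq0).
  rewrite (chi_long_eq rep two_neq0 j (Ordinal r_gt0)) -chi_s.
  by rewrite [in RHS]/Y0 [in RHS]chi_y_realN opprK.
split.
- move=> _ k [j ->]; rewrite (chi_y_realN chi (eps j *+ 2)) even_t; split=> //.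
  by rewrite -mulrN even_t.
- move=> _ k [j ->]; rewrite (chi_y_realN chi (eps j *+ 2)) odd_s; split=> //.
  have -> : - (2 * k + 1) = 2 * (- k - 1) + 1 by ring.
  by rewrite odd_s opprK.
- by move=> a k; exact: chi_short.
- by move=> k i _; exact: chi_imag.
Qed.
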